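(* For every $\mathrm{S2S}+\forall^{=1}_{\pi}$ formula $\phi(Z_1,\dots,Z_n)$ there exists an $\mathrm{S2S}+\forall^{=1}$ formula $\phi'(Z_1,\dots,Z_n)$ such that $\phi$ and $\phi'$ define the same set.
   Context: $\mathrm{S2S}$ is monadic second-order logic of the full binary tree $(\{\mathtt{L},\mathtt{R}\}^\ast,\mathrm{succ}_L,\mathrm{succ}_R)$ with $\mathrm{succ}_L=\{(w,w\mathtt{L})\}$, $\mathrm{succ}_R=\{(w,w\mathtt{R})\}$: formulas are built from atoms $\mathrm{succ}_L(x,y)$, $\mathrm{succ}_R(x,y)$, $x\in X$ using $\neg,\vee$, first-order quantification over vertices and second-order quantification over sets of vertices; a formula with free second-order variables defines the set of tuples of sets of vertices satisfying it. Sets of vertices are identified with trees in $T_{\{0,1\}}=\{0,1\}^{\{\mathtt{L},\mathtt{R}\}^\ast}$. $\mu_t$ is the product probability measure on $T_{\{0,1\}}$ labelling each vertex independently with $0$ or $1$ with probability $\tfrac12$. A path is a set of vertices containing the root, closed under prefixes, in which every element has exactly one child; the set $\mathcal{P}$ of paths is identified with $\{\mathtt{L},\mathtt{R}\}^\omega$, carrying the uniform product probability measure $\mu_w$. $\mathrm{S2S}+\forall^{=1}$ adds the quantifier $\forall^{=1}X.\,\phi$: a tuple $t$ satisfies $\forall^{=1}X.\,\phi(X,\vec{Y})$ iff $\mu_t(\{t'\in T_{\{0,1\}}\mid (t',t)\text{ satisfies }\phi\})=1$. $\mathrm{S2S}+\forall^{=1}_\pi$ adds the quantifier $\forall^{=1}_\pi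 X.\,\phi$: a tuple $t$ satisfies $\forall^{=1}_\pi X.\,\phi(X,\vec{Y})$ iff $\mu_w(\{p\in\mathcal{P}\mid (p,t)\text{ satisfies }\phi\})=1$. *)

(* Defs.v *)
From HB Require Import structures.
From mathcomp Require Import all_boot all_order all_algebra.
From mathcomp Require Import all_classical all_reals all_analysis.
From mathcomp Require Import measurable_realfun lra.

Set Implicit Arguments.
Unset Strict Implicit.
Unset Printing Implicit Defensive.
Import Order.TTheory GRing.Theory Num.Theory.
Import numFieldNormedType.Exports.

Local Open Scope classical_set_scope.
Local Open Scope ring_scope.

Definition coin_events (I : Type) : set (set (I -> bool)) :=
  [set A | exists i b, A = [set f : I -> bool | f i = b]].

(* [I -> bool] with the product sigma-algebra *)
Notation coin_space I := (g_sigma_algebraType (@coin_events I)).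

Definition is_coin_measure (R : realType) (I : eqType)
    (P : set (coin_space I) -> \bar R) : Prop :=
  forall (s : seq I) (b : I -> bool), uniq s ->
    P [set f : I -> bool | {in s, f =1 b}] = ((2^-1) ^+ size s)%:E.

Lemma measurable_coin_cylinder (I : eqType) (s : seq I) (b : I -> bool) :
  measurable ([set f : I -> bool | {in s, f =1 b}] : set (coin_space I)).
Proof.
elim: s => [|i s IH].
  rewrite (_ : mkset _ = setT); first exact: measurableT.
  by apply/seteqP; split=> // f _ i.
rewrite (_ : mkset _ = [set f : I -> bool | f i = b i] `&` [set f : I -> bool | {in s, f =1 b}]).
  apply: measurableI => //; apply: sub_sigma_algebra.
  by exists i, (b i).
apply/seteqP; split=> f /= H.
  by split=> [|j js]; apply: H; rewrite !inE ?eqxx ?js ?orbT.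
by move=> j; rewrite inE => /predU1P[->|]; [exact: H.1|exact: H.2].
Qed.

Section CoinMeasureExistence.
Variable R : realType.

(* The coin measure is the law of the binary digits of a uniform point of [0, 1[. *)
Let dbl (x : R) : R := if 2^-1 <= x then 2 * x - 1 else 2 * x.
Let digit n (x : R) : bool := 2^-1 <= iter n dbl x.

Let dyadic : nat -> (nat -> bool) -> R :=
  fix dyadic n b :=
    if n is m.+1 then ((b 0%N)%:R + dyadic m (b \o S)) / 2 else 0.

Let dyadic_bounds n b : 0 <= dyadic n b <= 1 - 2^-1 ^+ n.
Proof.
elim: n b => [|n IH] b /=; first by rewrite expr0; lra.
have := IH (b \o S); rewrite exprS.
by case: (b 0%N) => /=; lra.
Qed.

Let digitP n b x : 0 <= x < 1 ->
  (forall j, (j < n)%N -> digit j x = b j) <->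
  dyadic n b <= x < dyadic n b + 2^-1 ^+ n.
Proof.
elim: n b x => [|n IH] b x x01; first by rewrite /= expr0 add0r x01.
have dx01 : 0 <= dbl x < 1 by rewrite /dbl; case: ifPn; lra.
have := dyadic_bounds n (b \o S).
have := IH (b \o S) (dbl x) dx01.
rewrite [dyadic n.+1 b]/= exprS; set a := dyadic n _; set e := _ ^+ n.
move=> {}IH a_e; split=> [H|H].
  have /IH : forall j, (j < n)%N -> digit j (dbl x) = (b \o S) j.
    by move=> j jn; rewrite /= -(H j.+1)// /digit iterSr.
  have := H 0%N isT; rewrite /digit /= /dbl => <-.
  by case: ifPn => /=; lra.
have d0 : digit 0 x = b 0%N.
  rewrite /digit /=; case: (b 0%N) H => /=; first by lra.
  by move=> H; apply/negbTE; lra.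
case=> [//|j] jn; rewrite /digit iterSr.
suff /IH/(_ j jn) : a <= dbl x < a + e by [].
move: d0 H; rewrite /digit /= /dbl => ->.
by case: (b 0%N) => /=; lra.
Qed.

Let measurable_dbl : measurable_fun setT (dbl : R -> R).
Proof.
apply: measurable_fun_ifT.
- exact: measurable_fun_ler.
- by apply: measurable_funB => //; exact: mulrl_measurable.
- exact: mulrl_measurable.
Qed.

Let measurable_digit n : measurable_fun setT (digit n : R -> bool).
Proof.
apply: measurable_fun_ler => //.
elim: n => [|n IH]; first exact: measurable_id.
exact: measurableT_comp.
Qed.

Let digits (s : seq nat) (b : nat -> bool) : set (measurableTypeR R) :=
  [set x | {in s, forall j, digit j x = b j}].

Let measurable_digits s b : measurable (digits s b).
Proof.
elim: s => [|j s IH].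
  by rewrite (_ : digits _ _ = setT) //; apply/seteqP; split=> // x _ j.
rewrite (_ : digits _ _ = (digit j @^-1` [set b j]) `&` digits s b).
  apply: measurableI => //.
  rewrite -[X in measurable X]setTI.
  exact: (measurable_digit j measurableT).
apply/seteqP; split=> x /= H.
  by split=> [|k ks]; apply: H; rewrite !inE ?eqxx ?ks ?orbT.
by move=> k; rewrite inE => /predU1P[->|]; [exact: H.1|exact: H.2].
Qed.

Let measurable_I01 : measurable (`[0, 1[%classic : set (measurableTypeR R)).
Proof. exact: measurable_itv. Qed.

Let unif : {measure set (measurableTypeR R) -> \bar R} :=
  mrestr lebesgue_measure measurable_I01.

Let unif_digits s b : uniq s -> unif (digits s b) = (2^-1 ^+ size s)%:E.
Proof.
have full n c : unif (digits (iota 0 n) c) = (2^-1 ^+ n)%:E.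
  rewrite /unif /= /mrestr.
  rewrite (_ : digits _ _ `&` _ =
      `[dyadic n c, dyadic n c + 2^-1 ^+ n[%classic); last first.
    apply/seteqP; split=> x /=; rewrite !in_itv /=.
      case=> H x01; apply/digitP => // j jn.
      by apply: H; rewrite mem_iota.
    move=> H; have x01 : 0 <= x < 1 by have := dyadic_bounds n c; lra.
    split=> // j; rewrite mem_iota /= add0n => jn.
    exact: (digitP n c x01).2.
  rewrite lebesgue_measure_itv /= lte_fin ltrDl exprn_gt0 ?invr_gt0 //.
  by rewrite -EFinB addrC addKr.
pose n := (\max_(j <- s) j).+1.
have : {subset s <= iota 0 n}.
  by move=> j js; rewrite mem_iota /= add0n ltnS (@leq_bigmax_seq _ s xpredT id).
move: n => n; have [m] := ubnP (n - size s)%N.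
elim: m s b => // m IH s b sm sn us.
have [/hasP[j]|/hasPn jn] := boolP (has [predC s] (iota 0 n)).
  move=> jn /= js.
  pose b' k := if k == j then ~~ b j else b k.
  have us' : uniq (j :: s) by rewrite /= js.
  have sn' : {subset j :: s <= iota 0 n}.
    by move=> k; rewrite inE => /predU1P[->//|]; exact: sn.
  have sm' : (n - size (j :: s) < m)%N.
    by have := uniq_leq_size us' sn'; rewrite size_iota => ?; rewrite subnSK.
  rewrite (_ : digits s b = digits (j :: s) b `|` digits (j :: s) b').
    have -> : unif (digits (j :: s) b `|` digits (j :: s) b') =
        (unif (digits (j :: s) b) + unif (digits (j :: s) b'))%E.
      apply: measureU => //.
      apply/seteqP; split=> // x [/= /(_ j) H1 /(_ j) H2].
      move: H1 H2; rewrite /b' mem_head eqxx => -> // /(_ isT).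
      by case: (b j).
    have -> : unif (digits (j :: s) b) = (2^-1 ^+ (size s).+1)%:E by exact: IH.
    have -> : unif (digits (j :: s) b') = (2^-1 ^+ (size s).+1)%:E by exact: IH.
    by rewrite -EFinD exprS; congr EFin; lra.
  apply/seteqP; split=> x /= H.
    have [bj|bj] := eqVneq (digit j x) (b j); [left|right].
      by move=> k; rewrite inE => /predU1P[->//|]; exact: H.
    move=> k; rewrite inE /b' => /predU1P[->|ks].
      by rewrite eqxx; case: (b j) bj; case: (digit j x).
    by case: eqP => [kj|_]; [rewrite -kj ks in js|exact: H].
  case: H => H k ks; rewrite H ?inE ?ks ?orbT // /b'.
  by case: eqP => // kj; rewrite -kj ks in js.
have ns : {subset iota 0 n <= s} by move=> k /jn /= /negPn.
have -> : size s = n.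
  have := uniq_leq_size us sn; have := uniq_leq_size (iota_uniq 0 n) ns.
  by rewrite size_iota => ns1 ns2; apply/eqP; rewrite eqn_leq ns1 ns2.
rewrite -(full n b); suff -> : digits s b = digits (iota 0 n) b by [].
by apply/seteqP; split=> x /= H k ks; apply: H; [exact: ns|exact: sn].
Qed.

Lemma coin_measure_exists (I : countType) :
  exists P : probability (coin_space I) R, is_coin_measure P.
Proof.
pose X (x : R) : coin_space I := fun i => digit (pickle i) x.
have mX : measurable_fun setT X.
  apply: (@measurability _ _ _ _ setT X (@coin_events I) erefl).
  move=> _ [_ [i [b ->]] <-].
  suff : measurable (setT `&` (digit (pickle i) : R -> bool) @^-1` [set b]) by [].
  by apply: measurable_digit.
pose P : set (coin_space I) -> \bar R := pushforward unif X.
have P0 : P set0 = 0%E by rewrite /P /pushforward preimage_set0 measure0.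
have Pge0 A : (0 <= P A)%E by exact: measure_ge0.
have Psigma : semi_sigma_additive P.
  move=> F mF tF _; rewrite /P /pushforward preimage_bigcup.
  apply: measure_sigma_additive.
    by move=> n; rewrite -[X in measurable X]setTI; exact: mX.
  apply/trivIsetP => /= i j _ _ ij; rewrite -preimage_setI.
  by move/trivIsetP : tF => /(_ _ _ _ _ ij) ->//; rewrite preimage_set0.
have law : is_coin_measure P.
  move=> s b us; pose c k := oapp b false (unpickle k).
  rewrite -(size_map pickle) -(unif_digits c) ?(map_inj_uniq (pcan_inj pickleK)) //.
  suff -> : digits (map pickle s) c = X @^-1` [set f : I -> bool | {in s, f =1 b}] by [].
  apply/seteqP; split=> x /= H i.
    by move=> si; rewrite [LHS](H (pickle i)) ?map_f // /c pickleK.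
  by case/mapP=> j js ->; rewrite /c pickleK /= -H.
have P1 : P setT = 1%E.
  have := law [::] (fun=> false) isT; rewrite expr0 => <-; congr P.
  by apply/seteqP; split=> // f _ i.
clearbody P => {X mX}.
pose mP := isMeasure.Build _ _ _ P P0 Pge0 Psigma.
pose Pm : {measure set (coin_space I) -> \bar R} := HB.pack P mP.
pose pP := Measure_isProbability.Build _ _ _ Pm P1.
pose Pp : probability (coin_space I) R := HB.pack P mP pP.
by exists Pp.
Qed.
End CoinMeasureExistence.

Lemma coin_measure_unique (R : realType) (I : eqType)
    (P Q : {measure set (coin_space I) -> \bar R}) :
  is_coin_measure P -> is_coin_measure Q ->
  forall A : set (coin_space I), measurable A -> P A = Q A.
Proof.
move=> PP QQ A mA.
pose cyl (s : seq I) b := [set f : I -> bool | {in s, f =1 b}].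
pose G := [set B : set (coin_space I) |
            B = set0 \/ exists s b, uniq s /\ B = cyl s b].
have cylT (b : I -> bool) : cyl [::] b = setT.
  by apply/seteqP; split=> // f _ i.
apply: (measure_unique G (fun=> setT)) => //.
- apply/seteqP; split=> [B|]; last first.
    apply: smallest_sub; first exact: sigma_algebra_measurable.
    move=> _ [->|[s [b [_ ->]]]]; first exact: measurable0.
    exact: measurable_coin_cylinder.
  apply: smallest_sub; first exact: smallest_sigma_algebra.
  move=> _ [i [b ->]]; apply: sub_sigma_algebra; right.
  exists [:: i], (fun=> b); split=> //.
  apply/seteqP; split=> f /= fb; last by apply: fb; rewrite mem_head.
  by move=> j; rewrite inE => /eqP ->.
- move=> B C [->|[s [b [us ->]]]]; first by left; rewrite set0I.
  case=> [->|[t [c [ut ->]]]]; first by left; rewrite setI0.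
  have [h|h] := pselect (cyl s b `&` cyl t c !=set0); last first.
    by left; apply/eqP/negPn/negP => /set0P.
  case: h => f [fs ft]; right; exists (undup (s ++ t)), f.
  split; first exact: undup_uniq.
  apply/seteqP; split=> g /=.
    case=> gs gt i; rewrite mem_undup mem_cat => /orP[] si.
      by rewrite gs // fs.
    by rewrite gt // ft.
  move=> H; split=> i si; rewrite H ?mem_undup ?mem_cat ?si ?orbT //.
    exact: fs.
  exact: ft.
- by move=> _; right; exists [::], (fun=> false); rewrite cylT.
- by rewrite bigcup_const.
- move=> B [->|[s [b [us ->]]]]; first by rewrite !measure0.
  by rewrite PP // QQ.
- by move=> _; rewrite -(cylT (fun=> false)) PP // ltry.
Qed.

Definition coin_measure (R : realType) (I : countType) :
  probability (coin_space I) R := projT1 (cid (coin_measure_exists R I)).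

Lemma coin_measureP (R : realType) (I : countType) :
  is_coin_measure (coin_measure R I).
Proof. exact: projT2 (cid (coin_measure_exists R I)). Qed.

(* [A] belongs to the completion of the sigma-algebra and its completed measure
   is 1: sets defined by formulas need not be Borel. *)
Definition has_measure1 d (T : measurableType d) (R : realType)
    (mu : {measure set T -> \bar R}) (A : set T) : Prop :=
  exists B N, [/\ measurable B, mu.-negligible N, A = B `|` N & mu B = 1%E].

Lemma has_measure1P d (T : measurableType d) (R : realType)
    (mu : {measure set T -> \bar R}) (A : set T) :
  measurable A -> has_measure1 mu A <-> mu A = 1%E.
Proof.
move=> mA; split=> [[B [N [mB negN AE muB]]]|muA]; last first.
  exists A, set0; split=> //; last by rewrite setU0.
  exact: negligible_set0.
case: (negN) => C [mC C0 NC]; apply/eqP; rewrite eq_le; apply/andP; split.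
  rewrite -muB -[leRHS]adde0 -C0.
  apply: (@le_trans _ _ (mu (B `|` C))); last exact: measureU2.
  apply: le_measure; rewrite ?inE //; first exact: measurableU.
  by rewrite AE; apply: setUS.
by rewrite -muB; apply: le_measure; rewrite ?inE // AE; exact: subsetUl.
Qed.

Definition dir := bool.
Definition dirL : dir := false.
Definition dirR : dir := true.

Definition vertex := seq dir.
(* a set of vertices, i.e. an element of T_{0,1} *)
Definition tree := vertex -> bool.

Definition succL (x y : vertex) : Prop := y = rcons x dirL.
Definition succR (x y : vertex) : Prop := y = rcons x dirR.

Definition paths : set tree := [set X |
  [/\ X [::],
      forall u v : vertex, X (u ++ v) -> X u &
      forall w : vertex, X w -> exists! d : dir, X (rcons w d)]].

(* the identification of {L,R}^omega with the set of paths *)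
Definition path_of (p : nat -> dir) : tree := fun w => w == mkseq p (size w).

Lemma path_of_bij : set_bij setT paths path_of.
Proof.
split.
- move=> p _ /=; split=> //.
    move=> u v /eqP E; apply/eqP; have := congr1 (take (size u)) E.
    by rewrite take_size_cat // size_cat -[in mkseq _ _]/(mkseq _ _)
      /mkseq -map_take take_iota (minn_idPl (leq_addr _ _)).
  move=> w /eqP E; exists (p (size w)); split.
    by rewrite /path_of size_rcons mkseqS -E.
  move=> d; rewrite /path_of size_rcons mkseqS -E => /eqP.
  by move/rcons_inj => [].
- move=> p q _ _ E; apply/funext => n.
  have := congr1 (fun X : tree => X (mkseq p n.+1)) E.
  rewrite /path_of size_mkseq eqxx => /esym/eqP/(congr1 (nth false ^~ n)).
  by rewrite !nth_mkseq.
- move=> X [X0 Xpre Xchild].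
  have next (w : vertex) : {d : dir | X w -> X (rcons w d)}.
    by apply: cid; have [/Xchild[d [Xd _]]|] := pselect (X w);
      [exists d|exists false].
  pose pre := fix pre n := if n is m.+1 then rcons (pre m) (sval (next (pre m)))
                           else [::].
  pose p n := sval (next (pre n)).
  have preE n : pre n = mkseq p n by elim: n => // n IH; rewrite mkseqS -IH.
  have Xpren n : X (pre n).
    by elim: n => //= n IH; exact: (svalP (next (pre n))).
  exists p => //; apply/funext => w; apply/idP/idP; rewrite /path_of.
    by move/eqP ->; rewrite -preE.
  elim/last_ind: w => // w d IH Xwd.
  have Xw : X w by apply: (Xpre w [:: d]); rewrite cats1.
  have /eqP wE := IH Xw.
  rewrite size_rcons mkseqS -wE; apply/eqP; congr rcons.
  have [d' [_ dU]] := Xchild _ Xw; rewrite -(dU _ Xwd); apply: dU.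
  by have := Xpren (size w).+1; rewrite preE mkseqS -wE.
Qed.

(* which quantifier is added to S2S: over all sets of vertices or over paths *)
Inductive measure_quantifier := forall1 | forall1_path.

(* [formula q m n]: [m] free first-order and [n] free second-order variables,
   as de Bruijn indices, 0 being the innermost quantifier. *)
Inductive formula (q : measure_quantifier) : nat -> nat -> Type :=
| SuccL m n : 'I_m -> 'I_m -> formula q m n
| SuccR m n : 'I_m -> 'I_m -> formula q m n
| In m n : 'I_m -> 'I_n -> formula q m n
| Not m n : formula q m n -> formula q m n
| Or m n : formula q m n -> formula q m n -> formula q m n
| Exists1 m n : formula q m.+1 n -> formula q m n
| Forall1 m n : formula q m.+1 n -> formula q m n
| Exists2 m n : formula q m n.+1 -> formula q m n
| Forall2 m n : formula q m n.+1 -> formula q m n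
| AlmostAll m n : formula q m n.+1 -> formula q m n.

Definition extend (T : Type) (n : nat) (x : T) (e : 'I_n -> T)
    (i : 'I_n.+1) : T :=
  if unlift ord0 i is Some j then e j else x.

Definition probability1 (R : realType) (q : measure_quantifier)
    (A : set tree) : Prop :=
  match q with
  | forall1 => has_measure1 (coin_measure R vertex) A
  | forall1_path =>
      has_measure1 (coin_measure R nat) (path_of @^-1` (paths `&` A))
  end.

Fixpoint sat (R : realType) (q : measure_quantifier) (m n : nat)
    (phi : formula q m n) : ('I_m -> vertex) -> ('I_n -> tree) -> Prop :=
  match phi with
  | SuccL _ _ x y => fun v _ => succL (v x) (v y)
  | SuccR _ _ x y => fun v _ => succR (v x) (v y)
  | In _ _ x X => fun v V => V X (v x)
  | Not _ _ f => fun v V => ~ sat R f v V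
  | Or _ _ f g => fun v V => sat R f v V \/ sat R g v V
  | Exists1 _ _ f => fun v V => exists x, sat R f (extend x v) V
  | Forall1 _ _ f => fun v V => forall x, sat R f (extend x v) V
  | Exists2 _ _ f => fun v V => exists X, sat R f v (extend X V)
  | Forall2 _ _ f => fun v V => forall X, sat R f v (extend X V)
  | AlmostAll _ _ f => fun v V =>
      probability1 R q [set X | sat R f v (extend X V)]
  end.

Definition S2S_forall1 n := formula forall1 0 n.
Definition S2S_forall1_path n := formula forall1_path 0 n.

Definition defined_set (R : realType) q n (phi : formula q 0 n) :
    set ('I_n -> tree) :=
  [set Z | sat R phi (fun i : 'I_0 => [::]) Z].

(* Main.v *)
(** A random set of vertices [X] yields a random path [walk X]: start at the root and
    go right exactly when the current vertex is in [X].  This path is definable in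
    S2S and its law is [mu_w], so "almost every path" is replaced by "for almost every
    [X], the path that follows [X]".

    Sets defined by formulas are only measurable for the completion, so it must also
    be shown that if [walk @^-1` A] has completed measure 1 then so has [A].  For a
    sequence [r] of bits, [twist r] relabels the tree so that it preserves [mu_t] and
    [walk (twist r X) = walk X (+) r].  If [C] is a Borel subset of [walk @^-1` A] of
    measure 1, then by Tonelli there is a tree [X] such that [twist r X \in C] for
    almost all [r]; hence [walk X (+) r \in A] for almost all [r], and [A] has measure
    1 since translations preserve [mu_w]. *)
Require Import Defs.
From mathcomp Require Import all_boot all_order all_algebra.
From mathcomp Require Import all_classical all_reals all_analysis.
From mathcomp Require Import measurable_realfun.

Set Implicit Arguments.
Unset Strict Implicit.
Unset Printing Implicit Defensive.
Import Order.TTheory GRing.Theory Num.Theory.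

Local Open Scope classical_set_scope.
Local Open Scope ring_scope.

(** * Sets of completed measure 1 and sections of product sets *)

Section Measure1.
Context d (T : measurableType d) (R : realType) (P : probability T R).

Lemma has_measure1_subset (A : set T) :
  has_measure1 P A <-> exists B, [/\ measurable B, B `<=` A & P B = 1%E].
Proof.
split=> [[B [N [mB _ -> PB]]]|[B [mB BA PB]]].
  by exists B; split=> //; exact: subsetUl.
(* The remainder is negligible because it lies in the complement of [B], which has measure 0. *)
exists B, (A `\` B); split=> //; last by rewrite setDUK.
exists (~` B); split; first exact: measurableC.
  by transitivity (1 - P B)%E; [exact: probability_setC|rewrite PB subee].
by move=> x [].
Qed.

(** By Tonelli, the complement of [E] is null for the product measure, its sections over every [x]
    being null. Hence its sections over almost every [y] are null, and such a [y] exists because [Q]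
    has total mass 1. *)
Lemma probability_section1 d' (T' : measurableType d') (Q : probability T' R)
    (E : set (T * T')) : measurable E ->
  (forall x, Q (xsection E x) = 1%E) -> exists y, P (ysection E y) = 1%E.
Proof.
move=> mE QE; pose f (y : T') : \bar R := P (ysection (~` E) y).
have mC := measurableC mE.
have mf : measurable_fun setT f by exact: measurable_fun_ysection.
have f0 : (\int[Q]_y `|f y| = 0)%E.
  rewrite (eq_integral f); last by move=> y _; rewrite gee0_abs.
  transitivity ((P \x^ Q)%E (~` E)); first by [].
  rewrite -(product_measure_unique (m1 := P) (m2 := Q)) //; last first.
    by move=> A B mA mB; exact: product_measure2E.
  rewrite /product_measure1 integral0_eq // => x _ /=.
  rewrite -[xsection _ _]/(xsection (~` E) x).
  rewrite (_ : xsection _ _ = ~` xsection E x); last first.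
    by apply/seteqP; split=> y /=; rewrite /xsection /= !inE.
  rewrite probability_setC ?QE ?subee //; exact: measurable_xsection.
have [y fy] : exists y, f y = 0%E.
  have /(ae_eq_integral_abs Q measurableT mf) [N [mN QN sN]] := f0.
  apply: contrapT => nf; move: QN.
  suff -> : N = setT.
    by rewrite [LHS](probability_setT Q) => /eqP; rewrite onee_eq0.
  by apply/seteqP; split=> // y _; apply: sN => /= H; apply: nf; exists y; exact: H.
exists y; rewrite -[ysection E y]setCK probability_setC; last first.
  by apply: measurableC; exact: measurable_ysection.
rewrite (_ : ~` _ = ysection (~` E) y); last first.
  by apply/seteqP; split=> x /=; rewrite /ysection /= !inE.
by rewrite -/(f y) fy sube0.
Qed.
End Measure1.

Lemma measurable_preimageT d1 d2 (T1 : measurableType d1) (T2 : measurableType d2)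
    (f : T1 -> T2) (A : set T2) :
  measurable_fun setT f -> measurable A -> measurable (f @^-1` A).
Proof. by move=> mf mA; rewrite -[X in measurable X]setTI; exact: mf. Qed.

(** Splitting along the countably many values of [f] makes evaluation at a random index
    measurable. *)
Lemma measurable_preimage_fiber d (T : measurableType d) (V : countType)
    (f : T -> V) (F : V -> T -> bool) :
  (forall v, measurable (f @^-1` [set v])) ->
  (forall v, measurable [set x | F v x]) -> measurable [set x | F (f x) x].
Proof.
move=> mf mF.
rewrite (_ : mkset _ = \bigcup_v (f @^-1` [set v] `&` [set x | F v x])).
  apply: countable_bigcupT_measurable => [|v]; first exact: countableP.
  exact: measurableI.
by apply/seteqP; split=> x /= => [Fx|[v _ [/= ->]]] //; exists (f x).
Qed.

(** * Coin spaces and their relabellings *)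

Section CoinSpace.
Context d (T : measurableType d) (I : Type).

Lemma measurable_coin (i : I) b :
  measurable ([set f | f i = b] : set (coin_space I)).
Proof. by apply: sub_sigma_algebra; exists i, b. Qed.

Lemma measurable_fun_coin (f : T -> coin_space I) :
  (forall i, measurable [set x | (f x : I -> bool) i]) -> measurable_fun setT f.
Proof.
move=> mf; apply: (@measurability _ _ _ _ setT f (@coin_events I) erefl).
move=> _ [_ [i [[] ->]] <-]; rewrite setTI; first exact: mf.
rewrite (_ : _ @^-1` _ = ~` [set x | (f x : I -> bool) i]).
  exact: measurableC.
by apply/seteqP; split=> x /=; [move=> ->|move/negP/negbTE].
Qed.
End CoinSpace.

Section Relabel.
Context (R : realType) (I : countType) (s : I -> I) (c : I -> bool).

(** This form covers both [twist r] and, with [s = id], translation by [c]. *)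
Definition relabel (f : coin_space I) : coin_space I := fun i => f (s i) (+) c i.

Lemma measurable_relabel : measurable_fun setT relabel.
Proof.
apply: measurable_fun_coin => i; rewrite /relabel.
rewrite (_ : mkset _ = [set f : coin_space I | f (s i) = ~~ c i]).
  exact: measurable_coin.
by apply/seteqP; split=> f /=; case: (f _); case: (c _).
Qed.

(** Prescribing [relabel f] on a list [l] amounts to prescribing [f] on [map s l], which has no
    repetition when [l] has none, since [s] is injective. So the image measure agrees with the coin
    measure on cylinders, and uniqueness applies. *)
Lemma coin_measure_relabel (s' : I -> I) (A : set (coin_space I)) :
  cancel s s' -> measurable A ->
  coin_measure R I (relabel @^-1` A) = coin_measure R I A.
Proof.
move=> sK mA.
have P_coin : is_coin_measure
    (distribution (coin_measure R I) (mfun_Sub (mem_set measurable_relabel))).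
  move=> l b l_uniq; rewrite /distribution /pushforward.
  pose b' j := b (s' j) (+) c (s' j).
  have := coin_measureP R b' (etrans (map_inj_uniq (can_inj sK) l) l_uniq).
  rewrite size_map => <-; congr (coin_measure R I _).
  apply/seteqP; split=> f /= H i.
    by case/mapP=> j jl ->; rewrite /b' sK -(H j jl) /relabel addbK.
  by move=> il; rewrite /relabel (H (s i)) ?map_f // /b' sK addbK.
exact: (coin_measure_unique P_coin (@coin_measureP R I) mA).
Qed.
End Relabel.

(** * Walks down a random tree and their twists *)

Definition xor_word (r : nat -> bool) (w : vertex) : vertex :=
  mkseq (fun i => nth false w i (+) r i) (size w).

Lemma size_xor_word r w : size (xor_word r w) = size w.
Proof. exact: size_mkseq. Qed.

Lemma xor_wordK r : involutive (xor_word r).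
Proof.
move=> w; apply: (@eq_from_nth _ false); rewrite !size_xor_word // => i iw.
by rewrite !nth_mkseq ?size_xor_word // addbK.
Qed.

Lemma xor_word_rcons r w b :
  xor_word r (rcons w b) = rcons (xor_word r w) (b (+) r (size w)).
Proof.
rewrite /xor_word size_rcons mkseqS nth_rcons ltnn eqxx; congr rcons.
by apply/eq_in_map => i; rewrite mem_iota nth_rcons => /= ->.
Qed.

Lemma measurable_xor_word (w v : vertex) :
  measurable ([set r | xor_word r w = v] : set (coin_space nat)).
Proof.
have [vw|vw] := eqVneq (size v) (size w); last first.
  rewrite (_ : mkset _ = set0) //; apply/seteqP; split=> // r /= E.
  by rewrite -E size_xor_word eqxx in vw.
rewrite (_ : mkset _ = [set r : nat -> bool | {in iota 0 (size w), r =1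
    fun i => nth false v i (+) nth false w i}]).
  exact: measurable_coin_cylinder.
apply/seteqP; split=> r /= E.
  move=> i; rewrite mem_iota /= -E => iw.
  by rewrite nth_mkseq // addbC addKb.
apply: (@eq_from_nth _ false); rewrite size_xor_word // => i iw.
by rewrite nth_mkseq // E ?mem_iota // addbC addbK.
Qed.

Fixpoint walk_prefix (X : tree) n : vertex :=
  if n is m.+1 then rcons (walk_prefix X m) (X (walk_prefix X m)) else [::].

Definition walk (X : coin_space vertex) : coin_space nat :=
  fun n => (X : tree) (walk_prefix X n).

Lemma walk_prefixE X n : walk_prefix X n = mkseq (walk X) n.
Proof. by elim: n => // n IH; rewrite mkseqS -IH. Qed.

Lemma size_walk_prefix X n : size (walk_prefix X n) = n.
Proof. by rewrite walk_prefixE size_mkseq. Qed.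

(** Bit [n] is the label of [X] at a vertex that itself depends on [X]; induction on [n] shows that
    the fibres of this vertex are measurable. *)
Lemma measurable_walk : measurable_fun setT walk.
Proof.
apply: measurable_fun_coin => n; rewrite /walk.
apply: (measurable_preimage_fiber (F := fun w (X : coin_space vertex) => X w)).
  elim: n => [|n IH] w.
    have [->|w0] := eqVneq w [::].
      by rewrite (_ : _ @^-1` _ = setT) //; apply/seteqP; split.
    rewrite (_ : _ @^-1` _ = set0) //; apply/seteqP; split=> // X /= E.
    by rewrite E eqxx in w0.
  rewrite (_ : _ @^-1` _ =
      [set X | rcons (walk_prefix X n) ((X : tree) (walk_prefix X n)) == w]).
    apply: (measurable_preimage_fiber
      (F := fun u (X : coin_space vertex) => rcons u (X u) == w) IH) => u.
    case/lastP: w => [|w b].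
      rewrite (_ : mkset _ = set0) //; apply/seteqP; split=> // X /=.
      by case: u.
    have [<-|uw] := eqVneq u w.
      rewrite (_ : mkset _ = [set X : coin_space vertex | X u = b]).
        exact: measurable_coin.
      by apply/seteqP; split=> X /=; rewrite eqseq_rcons eqxx => /eqP.
    rewrite (_ : mkset _ = set0) //; apply/seteqP; split=> // X /=.
    by rewrite eqseq_rcons (negbTE uw).
  by apply/seteqP; split=> X /eqP.
move=> w; exact: measurable_coin.
Qed.

(** [xor_word r] is the tree automorphism that exchanges left and right at step [i] whenever [r i]
    is true. The added bit [r (size w)] makes the walk turn the other way at exactly those steps. *)
Definition twist (r : coin_space nat) : coin_space vertex -> coin_space vertex :=
  relabel (xor_word r) (fun w => r (size w)).

Lemma walk_twist r X : walk (twist r X) = relabel id r (walk X).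
Proof.
have prefix n : walk_prefix (twist r X) n = xor_word r (walk_prefix X n).
  elim: n => // n IH /=; rewrite IH xor_word_rcons; congr rcons.
  by rewrite /twist /relabel xor_wordK size_xor_word.
apply/funext => n; rewrite /walk prefix /twist /relabel xor_wordK.
by rewrite size_xor_word size_walk_prefix.
Qed.

Lemma measurable_twist :
  measurable_fun setT
    (fun x : coin_space nat * coin_space vertex => twist x.1 x.2).
Proof.
apply: measurable_fun_coin => w; rewrite /twist /relabel.
(* The label at [w] depends on [r] only through the pair below, which has countably many values. *)
apply: (measurable_preimage_fiber
  (f := fun x : coin_space nat * coin_space vertex =>
          (xor_word x.1 w, x.1 (size w)))
  (F := fun v (x : coin_space nat * coin_space vertex) => x.2 v.1 (+) v.2)).
  move=> [v b]; rewrite (_ : _ @^-1` _ =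
    fst @^-1` ([set r | xor_word r w = v] `&`
               [set r : coin_space nat | r (size w) = b])).
    apply: (measurable_preimageT measurable_fst).
    by apply: measurableI; [exact: measurable_xor_word|exact: measurable_coin].
  by apply/seteqP; split=> x /= [-> ->].
move=> [v b] /=; rewrite (_ : mkset _ =
    snd @^-1` [set X : coin_space vertex | X v = ~~ b]).
  by apply: (measurable_preimageT measurable_snd); exact: measurable_coin.
by apply/seteqP; split=> x /=; case: (x.2 v); case: b.
Qed.

(** * Transfer of measure 1 along the walk *)

Section WalkLaw.
Variable R : realType.
Let mu_t := coin_measure R vertex.
Let mu_w := coin_measure R nat.

Lemma coin_measure_twist r A : measurable A -> mu_t (twist r @^-1` A) = mu_t A.
Proof. by move=> mA; apply: coin_measure_relabel => //; exact: xor_wordK. Qed.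

(** For fixed [X] and random [r], the walk in [twist r X] is a translate of [r], so it lies in [D]
    almost surely. Tonelli then gives one [r] for which this holds for almost all [X], and [twist r]
    preserves [mu_t]. *)
Lemma coin_measure_walk1 D : measurable D ->
  mu_w D = 1%E -> mu_t (walk @^-1` D) = 1%E.
Proof.
move=> mD D1; have mwD := measurable_preimageT measurable_walk mD.
pose E := (fun x : coin_space vertex * coin_space nat => twist x.2 x.1) @^-1`
  (walk @^-1` D).
have mE : measurable E.
  apply: measurable_preimageT mwD.
  exact: (measurableT_comp measurable_twist (@measurable_swap _ _ _ _)).
have [r] : exists r, mu_t (ysection E r) = 1%E.
  apply: (@probability_section1 _ _ _ mu_t _ _ mu_w) => // X.
  rewrite -D1 -[RHS](coin_measure_relabel R (walk X) (s := id) (s' := id)) //.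
  rewrite (_ : xsection _ _ = relabel id (walk X) @^-1` D) //.
  apply/seteqP; split=> r; rewrite /xsection /= inE /E /= walk_twist;
    by rewrite (_ : relabel _ r _ = relabel id (walk X) r) //;
       apply/funext => n; exact: addbC.
rewrite (_ : ysection E r = twist r @^-1` (walk @^-1` D)) ?coin_measure_twist //.
by apply/seteqP; split=> X; rewrite /ysection /= inE.
Qed.

Lemma has_measure1_walk (A : set (nat -> bool)) :
  has_measure1 mu_t (walk @^-1` A) <-> has_measure1 mu_w A.
Proof.
rewrite !has_measure1_subset; split=> [[C [mC CA C1]]|[D [mD DA D1]]]; last first.
  exists (walk @^-1` D); split; [|by move=> X; exact: DA|exact: coin_measure_walk1].
  exact: measurable_preimageT measurable_walk mD.
pose E := (fun x : coin_space nat * coin_space vertex => twist x.1 x.2) @^-1` C.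
have mE : measurable E by exact: measurable_preimageT measurable_twist mC.
have [X X1] : exists X, mu_w (ysection E X) = 1%E.
  apply: (@probability_section1 _ _ _ mu_w _ _ mu_t) => // r.
  rewrite -C1 -(coin_measure_twist r mC); congr (mu_t _).
  by apply/seteqP; split=> X; rewrite /xsection /= !inE.
(* Translating twice by [walk X] is the identity, so every [q] in this set is the walk of a tree in
   [C]. *)
exists (relabel id (walk X) @^-1` ysection E X).
have mX : measurable (ysection E X) by exact: measurable_ysection.
split; last by rewrite (coin_measure_relabel R (walk X) (s := id) (s' := id)).
  exact: measurable_preimageT (measurable_relabel _ _) mX.
move=> q; rewrite /ysection /= inE /E /= => /CA /=; rewrite walk_twist.
rewrite (_ : relabel _ _ (walk X) = q) //; apply/funext => n.
by rewrite /relabel addbC addbK.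
Qed.
End WalkLaw.

(** * Definability of the walk and translation of formulas *)

Lemma extend0 T n (x : T) (e : 'I_n -> T) : extend x e ord0 = x.
Proof. by rewrite /extend unlift_none. Qed.

Lemma extendS T n (x : T) (e : 'I_n -> T) j : extend x e (lift ord0 j) = e j.
Proof. by rewrite /extend liftK. Qed.

Definition lift_renaming k l (rho : 'I_k -> 'I_l) (i : 'I_k.+1) : 'I_l.+1 :=
  if unlift ord0 i is Some j then lift ord0 (rho j) else ord0.

Lemma extend_renaming T k l (rho : 'I_k -> 'I_l) (x : T) (e : 'I_l -> T) :
  extend x e \o lift_renaming rho = extend x (e \o rho).
Proof.
apply/funext => i /=; rewrite /lift_renaming /extend.
by case: (unlift ord0 i) => [j|]; rewrite ?liftK ?unlift_none.
Qed.

Section Connectives.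
Context (R : realType) (q : measure_quantifier) (m n : nat).
Implicit Types f g : formula q m n.

Definition And f g : formula q m n := Not (Or (Not f) (Not g)).
Definition Imp f g : formula q m n := Or (Not f) g.
Definition Iff f g : formula q m n := And (Imp f g) (Imp g f).

Lemma sat_And f g v V : sat R (And f g) v V <-> sat R f v V /\ sat R g v V.
Proof. by split=> /= [/not_orP[/contrapT ? /contrapT]|[? ?] []]. Qed.

Lemma sat_Imp f g v V : sat R (Imp f g) v V <-> (sat R f v V -> sat R g v V).
Proof. by rewrite /= implyE. Qed.

Lemma sat_Iff f g v V : sat R (Iff f g) v V <-> (sat R f v V <-> sat R g v V).
Proof. by rewrite sat_And !sat_Imp; split=> -[]. Qed.
End Connectives.

(** A local description of the path taken by [walk X]: it mentions only the root and the edges,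
    hence can be written as a formula. *)
Definition follows (X Y : tree) : Prop :=
  Y [::] /\ forall w d, Y (rcons w d) <-> Y w /\ X w = d.

Lemma followsP (X Y : tree) : follows X Y <-> Y = path_of (walk X).
Proof.
have pathS w d : path_of (walk X) (rcons w d) <-> path_of (walk X) w /\ X w = d.
  rewrite /path_of size_rcons mkseqS eqseq_rcons; split.
    by case/andP=> /eqP wE /eqP ->; rewrite -wE eqxx /walk walk_prefixE -wE.
  by case=> /eqP wE <-; rewrite -wE eqxx /walk walk_prefixE -wE /=.
split=> [[Y0 YS]|->]; last by split.
apply/funext => w; elim/last_ind: w => [|w d IH]; first by rewrite Y0.
by apply/idP/idP => [/YS|/pathS]; rewrite -?IH => H;
  [apply/pathS; rewrite -IH|apply/YS].
Qed.

Section Follows.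
Context (R : realType) (q : measure_quantifier) (m n : nat) (X Y : 'I_n).
Let one k : 'I_k.+2 := lift ord0 ord0.

(** Here [one _] stands for the parent and [ord0] for the child. *)
Definition FollowsStep : formula q m.+2 n :=
  And (Imp (SuccL q n (one _) ord0)
         (Iff (In q ord0 Y) (And (In q (one _) Y) (Not (In q (one _) X)))))
      (Imp (SuccR q n (one _) ord0)
         (Iff (In q ord0 Y) (And (In q (one _) Y) (In q (one _) X)))).

(** The language has no name for the root: it lies in [Y] iff every vertex is in [Y] or has a
    parent. *)
Definition Follows : formula q m n :=
  And (Forall1 (Or (In q ord0 Y)
         (Exists1 (Or (SuccL q n ord0 (one _)) (SuccR q n ord0 (one _))))))
      (Forall1 (Forall1 FollowsStep)).

Lemma sat_FollowsStep v V x y : sat R FollowsStep (extend y (extend x v)) V <->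
  forall d, y = rcons x d -> (V Y y <-> V Y x /\ V X x = d).
Proof.
rewrite sat_And !sat_Imp !sat_Iff !sat_And /= /succL /succR.
rewrite !extendS !extend0.
have notX : ~ V X x <-> V X x = dirL by split=> [/negP/negbTE|->].
rewrite notX; split=> [[stepL stepR] [] yE|step].
- by rewrite (stepR yE).
- by rewrite (stepL yE).
by split=> yE; rewrite (step _ yE).
Qed.

Lemma sat_Follows v V : sat R Follows v V <-> follows (V X) (V Y).
Proof.
rewrite sat_And; split=> [[root step]|[root step]]; split.
- have /= := root [::]; rewrite extend0 => -[//|[u]].
  by rewrite /succL /succR !extendS !extend0; case: u => [|? ?] [].
- move=> w d; have /sat_FollowsStep : sat R FollowsStep
    (extend (rcons w d) (extend w v)) V by exact: step w (rcons w d).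
  exact.
- move=> w /=; rewrite extend0; case/lastP: w => [|w d]; [by left|right].
  exists w; rewrite /succL /succR !extendS !extend0.
  by case: d; [right|left].
- by move=> w u; apply/sat_FollowsStep => d ->.
Qed.
End Follows.

(* [rho] is needed for the induction to pass under [AlmostAll], whose translation binds
   two variables instead of one. *)
Lemma forall1_path_to_forall1 (R : realType) m k (phi : formula forall1_path m k) l
    (rho : 'I_k -> 'I_l) :
  exists phi' : formula forall1 m l,
    forall v V, sat R phi v (V \o rho) <-> sat R phi' v V.
Proof.
elim: phi l rho => {m k} [m k x y|m k x y|m k x X|m k f IHf|m k f IHf g IHg
  |m k f IHf|m k f IHf|m k f IHf|m k f IHf|m k f IHf] l rho.
- by exists (SuccL _ _ x y).
- by exists (SuccR _ _ x y).
- by exists (In _ x (rho X)).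
- have [f' f'E] := IHf _ rho; exists (Not f') => v V /=.
  by split=> nf /f'E.
- have [f' f'E] := IHf _ rho; have [g' g'E] := IHg _ rho.
  by exists (Or f' g') => v V /=; rewrite f'E g'E.
- have [f' f'E] := IHf _ rho; exists (Exists1 f') => v V /=.
  by split=> -[x /f'E]; exists x.
- have [f' f'E] := IHf _ rho; exists (Forall1 f') => v V /=.
  by split=> H x; apply/f'E.
- have [f' f'E] := IHf _ (lift_renaming rho); exists (Exists2 f') => v V /=.
  by split=> -[X H]; exists X; move: H; rewrite -f'E extend_renaming.
- have [f' f'E] := IHf _ (lift_renaming rho); exists (Forall2 f') => v V /=.
  by split=> H X; have := H X; rewrite -f'E extend_renaming.
(* Index 0 will be the path [Y] and index 1 the tree [X]; this renaming makes [f'] skip index 1. *)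
- have [f' f'E] := IHf _ (lift_renaming (lift ord0 \o rho)).
  pose g := And (Follows _ _ (lift ord0 ord0) ord0) f'.
  (* As [X] determines the [Y] that follows it, the existential quantifier merely names this
     path. *)
  exists (AlmostAll (Exists2 g)) => v V.
  pose A := [set X | sat R f v (extend X (V \o rho))].
  pose B := [set X | exists Y, sat R g v (extend Y (extend X V))].
  change (has_measure1 (coin_measure R nat) (path_of @^-1` (paths `&` A)) <->
          has_measure1 (coin_measure R vertex) B).
  rewrite -has_measure1_walk; suff -> : walk @^-1` (path_of @^-1` (paths `&` A)) = B
    by [].
  have E X Y : extend Y (extend X V) \o lift_renaming (lift ord0 \o rho) =
      extend Y (V \o rho).
    rewrite extend_renaming; congr extend.
    by apply/funext => i /=; rewrite extendS.
  apply/seteqP; split=> X.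
    case=> _ H; exists (path_of (walk X)); apply/sat_And; split.
      by apply/sat_Follows/followsP; rewrite extendS !extend0.
    by apply/f'E; rewrite E.
  case=> Y /sat_And[/sat_Follows/followsP]; rewrite extendS !extend0 => -> /f'E.
  rewrite E => H; split=> //; exact: (set_bij_homo path_of_bij).
Qed.

Theorem theorem9p3 (R : realType) (n : nat) (phi : S2S_forall1_path n) :
  exists phi' : S2S_forall1 n, defined_set R phi = defined_set R phi'.
Proof.
have [phi' phi'E] := forall1_path_to_forall1 R phi id.
by exists phi'; apply/seteqP; split=> V /phi'E.
Qed.
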